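(* Let $A \in \mathbb{R}^{n\times n}$. If the interval matrix $[A - I_n, A + I_n]$ is singular, then it is not the case that the absolute value equation $Ax - |x| = b$ has exactly one solution $x\in\mathbb{R}^n$ for every $b \in \mathbb{R}^n$; that is, there exists $b \in \mathbb{R}^n$ for which the equation $Ax - |x| = b$ does not have exactly one solution.
   Context: For a vector $x \in \mathbb{R}^n$, $|x|$ denotes the vector of component-wise absolute values of $x$. $I_n$ is the $n\times n$ identity matrix. For $A, \Delta \in \mathbb{R}^{n\times n}$ with $\Delta \geq 0$ entrywise, the interval matrix $[A-\Delta, A+\Delta]$ is the set of all $K \in \mathbb{R}^{n\times n}$ with $A-\Delta \leq K \leq A+\Delta$ entrywise; it is called regular if each such $K$ is invertible, and singular otherwise. *)

(* Defs.v *)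
From HB Require Import structures.
From mathcomp Require Import all_boot all_order all_algebra.
From mathcomp Require Import reals.

Set Implicit Arguments.
Unset Strict Implicit.
Unset Printing Implicit Defensive.

Import Order.TTheory GRing.Theory Num.Theory.

Local Open Scope ring_scope.

Definition lemx (R : realType) (m n : nat) (A B : 'M[R]_(m, n)) : Prop :=
  forall i j, A i j <= B i j.

(* Componentwise absolute values; not to be confused with the sup norm that
   MathComp-Analysis puts on matrices under the notation `|x|. *)
Definition absmx (R : realType) (m n : nat) (A : 'M[R]_(m, n)) : 'M[R]_(m, n) :=
  map_mx (fun a : R => `|a|) A.

(* Membership of K in [A - Delta, A + Delta]; Delta is intended to be
   entrywise nonnegative. *)
Definition in_interval_mx (R : realType) (n : nat) (A Delta K : 'M[R]_n) : Prop :=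
  lemx (A - Delta) K /\ lemx K (A + Delta).

Definition regular_interval_mx (R : realType) (n : nat)
    (A Delta : 'M[R]_n) : Prop :=
  forall K : 'M[R]_n, in_interval_mx A Delta K -> K \in unitmx.

Definition singular_interval_mx (R : realType) (n : nat)
    (A Delta : 'M[R]_n) : Prop :=
  ~ regular_interval_mx A Delta.

(* Main.v *)
(** If [f x = A x - |x|] is injective then [A - diag d] is nonsingular whenever
    [d] lies on an edge of the cube [[-1, 1]^n]: for a kernel vector [v], and
    [u] with the signs of [d], large off the free coordinate [i] and zero at
    [i], the two points [u + a v], [u + b v] with [a = 1 +- d_i] and
    [b = a - 2] have the same image.  Since [det (A - diag d)] is affine in
    each coordinate of [d], it has the same nonzero sign at adjacent vertices,
    hence at all vertices, hence on the whole cube, which contains every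
    diagonal perturbation occurring in the interval matrix. *)
Require Import Defs.
From mathcomp Require Import all_boot all_order all_algebra.
From mathcomp Require Import boolp reals.
From mathcomp Require Import ring lra.

Set Implicit Arguments.
Unset Strict Implicit.
Unset Printing Implicit Defensive.

Import Order.TTheory GRing.Theory Num.Theory.

Local Open Scope ring_scope.

Definition row_upd (R : Type) (n : nat) (d : 'rV[R]_n) (i : 'I_n) (t : R) :
    'rV[R]_n :=
  \row_j (if j == i then t else d 0 j).

Lemma row_upd_id (R : Type) (n : nat) (d : 'rV[R]_n) (i : 'I_n) :
  row_upd d i (d 0 i) = d.
Proof. by apply/rowP=> j; rewrite mxE; case: eqP => [->|]. Qed.

(** Induction on the number of coordinates failing [q]. With [q] as equality to 1 it walks through
    the vertices; with [q] as absolute value 1 it passes from the vertices to the cube. *)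
Lemma row_upd_ind (R : Type) (n : nat) (q : pred R) (P : 'rV[R]_n -> Prop) :
  (forall d : 'rV[R]_n, (forall i, q (d 0 i)) -> P d) ->
  (forall (d : 'rV[R]_n) i, ~~ q (d 0 i) -> (forall t, q t -> P (row_upd d i t)) -> P d) ->
  forall d, P d.
Proof.
move=> Pbase Pstep d; have [k] := ubnP #|[pred i | ~~ q (d 0 i)]|.
elim: k d => // k IHk d; rewrite ltnS => ledk.
have [/forallP|/forallPn[i qi]] := boolP [forall i, q (d 0 i)]; first exact: Pbase.
apply: (Pstep _ _ qi) => t qt; apply: IHk.
apply: (leq_trans _ ledk); apply/proper_card/properP; split.
  by apply/subsetP=> j; rewrite !inE mxE; case: eqP; rewrite ?qt.
by exists i; rewrite !inE // mxE eqxx qt.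
Qed.

(** Only row [i] involves [t], and the determinant is linear in that row; the weights write [t] as a
    combination of 1 and -1. *)
Lemma det_sub_diag_row_upd (R : realFieldType) (n : nat) (A : 'M[R]_n)
    (d : 'rV[R]_n) (i : 'I_n) (t : R) :
  \det (A - diag_mx (row_upd d i t)) =
    (1 + t) / 2 * \det (A - diag_mx (row_upd d i 1)) +
    (1 - t) / 2 * \det (A - diag_mx (row_upd d i (-1))).
Proof.
apply: (@determinant_multilinear _ _ _ _ _ i).
- apply/rowP=> j; rewrite !mxE eqxx.
  by case: (i == j); rewrite ?mulr1n ?mulr0n; field.
- by apply/matrixP=> k j; rewrite !mxE eq_sym (negPf (neq_lift _ _)).
- by apply/matrixP=> k j; rewrite !mxE eq_sym (negPf (neq_lift _ _)).
Qed.

(** Since [m * s] dominates [z], the sum stays on the side of 0 given by [s], where the absolute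
    value is linear. *)
Lemma normr_add_small (R : realFieldType) (s m z : R) :
  `|s| = 1 -> `|z| <= m -> `|m * s + z| = m + s * z.
Proof.
rewrite ler_norml => s1 /andP[zl zr].
have [s0|s0] := lerP 0 s.
  move: s1; rewrite ger0_norm // => ->; rewrite ger0_norm; lra.
move: s1; rewrite ltr0_norm // => /(canRL (@opprK _)) ->.
rewrite ler0_norm; lra.
Qed.

(** Take [a = 1 + e] or [a = 1 - e] by the sign of [v]. Then [a - 2 <= 0 <= a], so the absolute
    values of [a] and [a - 2] differ by [2 * a - 2], which is [2 * e] up to that sign. *)
Lemma exists_norm_increment (R : realFieldType) (e v : R) : `|e| <= 1 ->
  exists a, `|a| <= 2 /\ `|a - 2| <= 2 /\ `|a * v| - `|(a - 2) * v| = 2 * (e * v).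
Proof.
rewrite ler_norml => /andP[el er].
have [v0|v0] := lerP 0 v.
  exists (1 + e); rewrite !normrM (ger0_norm v0).
  rewrite (@ger0_norm _ (1 + e)) 1?(@ler0_norm _ (1 + e - 2)); [|lra|lra].
  by do 2?split; [lra|lra|ring].
exists (1 - e); rewrite !normrM (ltr0_norm v0).
rewrite (@ger0_norm _ (1 - e)) 1?(@ler0_norm _ (1 - e - 2)); [|lra|lra].
by do 2?split; [lra|lra|ring].
Qed.

Lemma det_edge_neq0 (R : realType) (n : nat) (A : 'M[R]_n) (d : 'rV[R]_n)
    (i : 'I_n) :
  injective (fun x : 'cV[R]_n => A *m x - absmx x) ->
  (forall j, j != i -> `|d 0 j| = 1) -> `|d 0 i| <= 1 ->
  \det (A - diag_mx d) != 0.
Proof.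
move=> finj dj di; apply/negP; rewrite -det_tr => /det0P[w w0 wK].
pose v := w^T.
have Av : A *m v = diag_mx d *m v.
  apply/eqP; rewrite -subr_eq0 -mulmxBl -[_ - _]trmxK -trmx_mul wK.
  by rewrite trmx0.
have [a [a2 [b2 abE]]] := exists_norm_increment (v i 0) di.
(* The factor 2 accommodates both coefficients [a] and [a - 2]. *)
pose m := 2 * \sum_j `|v j 0|.
have vm j c : `|c| <= 2 -> `|c * v j 0| <= m.
  move=> c2; rewrite normrM /m ler_pM //.
  by rewrite (bigD1 j) //= lerDl sumr_ge0.
pose u := \col_j (if j == i then 0 else m * d 0 j).
have /finj/eqP : A *m (u + a *: v) - absmx (u + a *: v) =
    A *m (u + (a - 2) *: v) - absmx (u + (a - 2) *: v).
  (* By [Av] the linear parts differ by [2 * (d 0 j * v j 0)] in coordinate [j]. The absolute values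
     differ by the same amount: by [abE] at [i], and elsewhere because [u] fixes the signs. *)
  rewrite !mulmxDr -!scalemxAr Av.
  apply/colP=> j; rewrite mul_diag_mx !mxE.
  have [->|ji] := eqVneq j i; first by rewrite !add0r; rewrite !mxE in abE *; lra.
  have := normr_add_small (dj _ ji) (vm j _ a2).
  have := normr_add_small (dj _ ji) (vm j _ b2).
  by rewrite !mxE => -> ->; ring.
rewrite (inj_eq (addrI _)) -subr_eq0 -scalerBl opprB addrC subrK scaler_eq0.
by rewrite pnatr_eq0 /= trmx_eq0 (negPf w0).
Qed.

Lemma det_adjacent_vertices (R : realType) (n : nat) (A : 'M[R]_n)
    (d : 'rV[R]_n) (i : 'I_n) :
  injective (fun x : 'cV[R]_n => A *m x - absmx x) ->
  (forall j, `|d 0 j| = 1) ->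
  0 < \det (A - diag_mx (row_upd d i 1)) *
      \det (A - diag_mx (row_upd d i (-1))).
Proof.
move=> finj dj.
have edge t : `|t| <= 1 -> \det (A - diag_mx (row_upd d i t)) != 0.
  move=> t1; apply: (@det_edge_neq0 _ _ _ _ i) => //; last by rewrite mxE eqxx.
  by move=> j /negPf ji; rewrite mxE ji.
have := edge 1; have := edge (-1).
have := fun t => det_sub_diag_row_upd A d i t.
set p := \det (A - diag_mx (row_upd d i 1)).
set q := \det (A - diag_mx (row_upd d i (-1))).
move=> detE; rewrite normrN normr1 => /(_ (lexx _)) q0 /(_ (lexx _)) p0.
rewrite ltNge; apply/negP => pq.
have pq_neq : q - p != 0.
  by apply/eqP => qp; move: p0; rewrite -sqrf_eq0 => /eqP; apply; nra.
(* This is the root in [t] of the affine interpolation [detE]; it lies in [-1, 1] because [(p + q)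
   ^+ 2 - (q - p) ^+ 2 = 4 * p * q <= 0]. *)
have t1 : `|(p + q) / (q - p)| <= 1.
  rewrite normrM normfV ler_pdivrMr ?normr_gt0 // mul1r.
  by rewrite -ler_sqr ?nnegrE // !real_normK ?num_real //; nra.
by have /eqP := edge _ t1; apply; rewrite detE; field.
Qed.

Lemma det_vertex (R : realType) (n : nat) (A : 'M[R]_n) (d : 'rV[R]_n) :
  injective (fun x : 'cV[R]_n => A *m x - absmx x) ->
  (forall j, `|d 0 j| = 1) ->
  0 < \det (A - 1%:M) * \det (A - diag_mx d).
Proof.
move=> finj; elim/(@row_upd_ind R n (pred1 1)): d => [d d1 _|d i di IHd dj].
  have -> : diag_mx d = 1%:M.
    by rewrite -diag_const_mx; congr diag_mx; apply/rowP=> j; rewrite mxE (eqP (d1 j)).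
  rewrite -expr2 lt_def sqr_ge0 sqrf_eq0 andbT.
  (* The edge lemma needs a coordinate to free, so dimension 0 is separate: the empty determinant is
     1. *)
  case: n A d d1 finj => [|n] A d d1 finj; first by rewrite det_mx00 oner_eq0.
  rewrite -diag_const_mx; apply: (@det_edge_neq0 _ _ _ _ ord0) => // [j _|];
    by rewrite mxE normr1.
have diE : d 0 i = -1.
  have /eqP := dj i; rewrite eqr_norml ler01 andbT => /orP[d1|/eqP //].
  by rewrite /= d1 in di.
have := det_adjacent_vertices i finj dj.
rewrite -diE row_upd_id.
have := IHd 1 (eqxx _).
have dj' j : `|row_upd d i 1 0 j| = 1 by rewrite mxE; case: ifP; rewrite ?normr1.
move=> /(_ dj').
set c := \det _; set p := \det (_ - diag_mx (row_upd _ _ _)); set q := \det _.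
(* Signs are transitive: the product of [c * p] and [p * q] is [c * q] times a square. *)
move=> cp pq; have : 0 < (c * q) * p ^+ 2 by have := mulr_gt0 cp pq; nra.
by rewrite pmulr_lgt0 // exprn_even_gt0 //=; apply/eqP => p0; rewrite p0 mulr0 ltxx in cp.
Qed.

Lemma det_cube (R : realType) (n : nat) (A : 'M[R]_n) (d : 'rV[R]_n) :
  injective (fun x : 'cV[R]_n => A *m x - absmx x) ->
  (forall j, `|d 0 j| <= 1) ->
  0 < \det (A - 1%:M) * \det (A - diag_mx d).
Proof.
move=> finj; elim/(@row_upd_ind R n (fun t => `|t| == 1)): d => [d d1 _|d i di IHd dj].
  by apply: det_vertex => // j; apply/eqP.
have IH t : `|t| = 1 -> 0 < \det (A - 1%:M) * \det (A - diag_mx (row_upd d i t)).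
  move=> t1; apply: IHd => [|j]; first exact/eqP.
  by rewrite mxE; case: ifP; rewrite ?t1.
have p0 := IH 1 (normr1 _); have q0 := IH (-1) (normrN1 _).
rewrite -(row_upd_id d i) det_sub_diag_row_upd.
have := dj i; rewrite ler_norml => /andP[tl tr].
(* Away from [t = 1] the weight [(1 - t) / 2] is strictly positive, which makes the convex
   combination strictly positive. *)
have [->|tn] := eqVneq (d 0 i) 1; first by nra.
have : d 0 i < 1 by rewrite lt_neqAle tn.
by nra.
Qed.

Lemma regular_of_injective (R : realType) (n : nat) (A : 'M[R]_n) :
  injective (fun x : 'cV[R]_n => A *m x - absmx x) ->
  regular_interval_mx A 1%:M.
Proof.
move=> finj K [KL KU].
(* The radius [1%:M] vanishes off the diagonal, so [K] can differ from [A] only on it, by at most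
   1. *)
pose d := \row_j (A j j - K j j).
have -> : K = A - diag_mx d.
  apply/matrixP=> i j; have := KL i j; have := KU i j; rewrite !mxE.
  have [->|ij] := eqVneq i j; rewrite ?mulr1n ?mulr0n; first by move=> *; ring.
  by lra.
rewrite unitmxE unitfE; have : 0 < \det (A - 1%:M) * \det (A - diag_mx d).
  apply: det_cube => // j; have := KL j j; have := KU j j.
  by rewrite !mxE eqxx mulr1n ler_norml => *; lra.
by apply: contraTneq => ->; rewrite mulr0 ltxx.
Qed.

Theorem proposition4 (R : realType) (n : nat) (A : 'M[R]_n)
    (hA : singular_interval_mx A 1%:M) :
  exists b : 'cV[R]_n, ~ (exists! x : 'cV[R]_n, A *m x - absmx x = b).
Proof.
apply: contrapT => hb; apply: hA; apply: regular_of_injective => x y fxy.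
have [z [_ zuniq]] : exists! z : 'cV[R]_n, A *m z - absmx z = A *m y - absmx y.
  (* The right-hand side is the common image of [x] and [y], so uniqueness there gives
     injectivity. *)
  by apply: contrapT => nuniq; apply: hb; exists (A *m y - absmx y).
by rewrite -(zuniq x fxy) -(zuniq y).
Qed.
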